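(* Let $(V,\Omega)$ be a symplectic vector space and let $\omega$ be the induced symplectic form on the manifold $V$. Then $(V,\omega)$ carries a unique symplectic potential $\theta^0$ that is invariant under the linear symplectic group ${\rm Sp}(V,\Omega)$ (i.e. there is exactly one smooth one-form $\theta^0$ on $V$ with ${\rm d}\theta^0=\omega$ and $g^*\theta^0=\theta^0$ for all $g\in{\rm Sp}(V,\Omega)$). Explicitly, for all $z,v\in V$, $$\theta^0_z(v_z)=\tfrac12\,\Omega(z,v).$$
   Context: A symplectic vector space $(V,\Omega)$ is a finite-dimensional real vector space $V$ with a nonsingular alternating bilinear form $\Omega$. Regard $V$ as a smooth manifold; for $z,v\in V$ let $v_z\in T_zV$ be the tangent vector given by $v_z\psi=\frac{\rm d}{{\rm d}t}\psi(z+tv)|_{t=0}$ for smooth $\psi:V\to\mathbb{R}$. The symplectic form $\omega$ on the manifold $V$ is defined by $\omega_z(x_z,y_z)=\Omega(x,y)$ for $x,y,z\in V$. A symplectic potential for $\omega$ is a smooth one-form $\theta$ on $V$ with ${\rm d}\theta=\omega$. ${\rm Sp}(V,\Omega)$ is the group of linear automorphisms $g$ of $V$ with $\Omega(gx,gy)=\Omega(x,y)$ for all $x,y\in V$. The exterior derivative is normalized so that ${\rm d}\theta(X,Y)=X(\theta(Y))-Y(\theta(X))-\theta([X,Y])$. *)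

(* Defs.v *)
From HB Require Import structures.
From mathcomp Require Import all_boot all_order all_algebra sesquilinear.
From mathcomp Require Import all_classical all_reals all_analysis.

Set Implicit Arguments.
Unset Strict Implicit.
Unset Printing Implicit Defensive.

Import Order.TTheory GRing.Theory Num.Theory.
Import numFieldNormedType.Exports.

Local Open Scope classical_set_scope.
Local Open Scope ring_scope.

(* [vectType R] carries no topology; that of the manifold V is read through
   the linear chart 'rV_(dim V) -> V given by a basis.  It does not depend on
   the basis. *)
Definition chart (R : realType) (V : vectType R) : 'rV[R]_(\dim {:V}) -> V :=
  passmx.vecof (vbasis {:V}).

Definition vcoord (R : realType) (V : vectType R) (i : 'I_(\dim {:V})) :
  V -> R := coord (vbasis {:V}) i.

(* The derivation v_z.  Since v |-> v_z identifies V with T_z V, a vector v is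
   also used for the tangent vector v_z. *)
Definition tangent (R : realType) (V : vectType R) (z v : V) (psi : V -> R) :
  R := derive1 (fun t : R => psi (z + t *: v)) 0.

Fixpoint Cn (R : realType) (V : vectType R) (k : nat) (psi : V -> R) : Prop :=
  continuous (psi \o @chart R V) /\
  if k is k'.+1 then
    forall v : V,
      (forall z : V, derivable (fun t : R => psi (z + t *: v)) 0 1) /\
      Cn k' (fun z => tangent z v psi)
  else True.

Definition smooth (R : realType) (V : vectType R) (psi : V -> R) : Prop :=
  forall k : nat, Cn k psi.

(* Used both for smooth self-maps of V and for smooth vector fields on V. *)
Definition smooth_map (R : realType) (V : vectType R) (F : V -> V) : Prop :=
  forall i : 'I_(\dim {:V}), smooth (@vcoord R V i \o F).

(* [Tmap F z v] is the image of v_z under the tangent map T_z F, in components: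
   sum_i v_z(F^i) e_i. *)
Definition Tmap (R : realType) (V : vectType R) (F : V -> V) (z v : V) : V :=
  \sum_(i < \dim {:V})
    tangent z v (@vcoord R V i \o F) *: (vbasis {:V})`_i.

Definition act (R : realType) (V : vectType R) (X : V -> V) (psi : V -> R) :
  V -> R := fun z => tangent z (X z) psi.

(* [X, Y]^i = X(Y^i) - Y(X^i) *)
Definition lie_bracket (R : realType) (V : vectType R) (X Y : V -> V) :
  V -> V := fun z => Tmap Y z (X z) - Tmap X z (Y z).

Definition one_form (R : realType) (V : vectType R) := V -> 'Hom(V, R^o).

Definition smooth_form (R : realType) (V : vectType R) (theta : one_form V) :
  Prop := forall v : V, smooth (fun z => theta z v : R).

Definition contract (R : realType) (V : vectType R) (theta : one_form V)
  (X : V -> V) : V -> R := fun z => theta z (X z).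

Definition ext_deriv (R : realType) (V : vectType R) (theta : one_form V)
  (X Y : V -> V) : V -> R := fun z =>
  act X (contract theta Y) z - act Y (contract theta X) z
  - contract theta (lie_bracket X Y) z.

Definition pullback (R : realType) (V : vectType R) (F : V -> V)
  (theta : one_form V) (z v : V) : R := theta (F z) (Tmap F z v).

Definition symplectic (R : realType) (V : vectType R) (Omega : {biscalar V}) :
  Prop :=
  (forall x : V, Omega x x = 0) /\
  (forall x : V, (forall y : V, Omega x y = 0) -> x = 0).

Definition Sp (R : realType) (V : vectType R) (Omega : {biscalar V}) :
  set 'End(V) :=
  [set g | bijective g /\ forall x y : V, Omega (g x) (g y) = Omega x y].

Definition induced_form (R : realType) (V : vectType R)
  (Omega : {biscalar V}) (z x y : V) : R := Omega x y.

Definition symplectic_potential (R : realType) (V : vectType R)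
  (omega : V -> V -> V -> R) (theta : one_form V) : Prop :=
  smooth_form theta /\
  forall X Y : V -> V, smooth_map X -> smooth_map Y ->
    forall z : V, ext_deriv theta X Y z = omega z (X z) (Y z).

Definition Sp_invariant (R : realType) (V : vectType R) (Omega : {biscalar V})
  (theta : one_form V) : Prop :=
  forall g : 'End(V), Sp Omega g ->
    forall z v : V, pullback g theta z v = theta z v.

(* Main.v *)
Require Import Defs.
From HB Require Import structures.
From mathcomp Require Import all_boot all_order all_algebra sesquilinear.
From mathcomp Require Import all_classical all_reals all_analysis.

Set Implicit Arguments.
Unset Strict Implicit.
Unset Printing Implicit Defensive.

Import Order.TTheory GRing.Theory Num.Theory.
Import numFieldNormedType.Exports.

Local Open Scope classical_set_scope.
Local Open Scope ring_scope.

(** The form [z |-> 2^-1 * Omega z v] is a potential by the Leibniz rule along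
lines: its exterior derivative on [X], [Y] is
[2^-1 * (Omega X Y - Omega Y X) = Omega X Y], the terms in the derivatives of
[X] and [Y] being cancelled by the bracket.  It is invariant because [g]
preserves [Omega] and is its own tangent map.

Let conversely [theta] be an invariant potential.

Invariance makes [theta] null on the radial direction.  The function
[f z = theta z z] is [Sp]-invariant, and [Sp] moves [z] to every [s *: z] with
[s != 0]: through an intermediate [w] with [Omega w z != 0], two transvections
do it.  Hence [f z = f (s *: z) = s * theta (s *: z) z], which tends to [0] with
[s], so [f = 0] ([Sp_invariant_null_on_rays]).

A potential null on the radial direction is determined by integration along
rays, as in the Poincare lemma ([potential_null_on_rays]).  Put
[h t = t * theta (t *: z) v].  Then
[h' t = theta (t *: z) v + t * d_z (theta v)], where the equation for the
exterior derivative gives [d_z (theta v) = d_v (theta z) + Omega z v], and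
differentiating [f = 0] in the direction [v] at [t *: z] gives
[theta (t *: z) v + t * d_v (theta z) = 0].  So [h' t = t * Omega z v], and
[theta z v = h 1 - h 0 = 2^-1 * Omega z v]. *)

(** * Derivatives along lines *)

Section Lines.
Variables (R : realType) (V : vectType R).
Implicit Types (psi : V -> R) (z v x y : V).

Lemma tangent_val psi z v (d : R) :
  is_derive (0 : R) 1 (fun t : R => psi (z + t *: v)) d -> tangent z v psi = d.
Proof.
by move=> h; rewrite /tangent derive1E (@derive_val _ _ _ _ _ _ _ h).
Qed.

Lemma smooth_is_derive psi z v :
  smooth psi ->
  is_derive (0 : R) 1 (fun t : R => psi (z + t *: v)) (tangent z v psi).
Proof.
move=> /(_ 1%N) [_ /(_ v) [d _]].
by rewrite /tangent derive1E; apply: derivableP; apply: d.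
Qed.

(** The derivative along a ray at a time [t] other than [0] is a tangent
derivative at the point [t *: z] reached, by translation of the parameter. *)
Lemma smooth_is_derive_ray psi z (t : R) :
  smooth psi ->
  is_derive t 1 (fun s : R => psi (s *: z)) (tangent (t *: z) z psi).
Proof.
move=> sm.
have -> : (fun s : R => psi (s *: z)) =
   (fun s => psi (t *: z + s *: z)) \o shift (- t).
  by apply/funext => s /=; rewrite -scalerDl addrCA subrr addr0.
rewrite -[tangent _ _ _]mulr1; apply: is_derive1_comp.
  by rewrite /= subrr; exact: smooth_is_derive.
exact: is_derive_shift.
Qed.

Lemma scalar_is_derive (l : {scalar V}) z v :
  is_derive (0 : R) 1 (fun t : R => l (z + t *: v)) (l v).
Proof.
have -> : (fun t : R => l (z + t *: v)) = cst (l z) + (l v \*: id).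
  by apply/funext => t /=; rewrite linearD linearZ /= mulrC.
by apply: is_derive_eq; rewrite add0r /GRing.scale /= mulr1.
Qed.

Lemma tangent_scalar (l : {scalar V}) z v : tangent z v l = l v.
Proof. exact/tangent_val/scalar_is_derive. Qed.

Lemma continuous_scalar_chart (l : {scalar V}) : continuous (l \o @chart R V).
Proof.
have -> : l \o @chart R V = \sum_(i < \dim {:V})
    (fun r : 'rV[R]_(\dim {:V}) => r 0 i * l (vbasis {:V})`_i).
  apply/funext => r; rewrite /= /chart /passmx.vecof linear_sum fct_sumE.
  by apply: eq_bigr => i _; rewrite linearZ.
apply: (@big_ind _ (fun f : 'rV[R]_(\dim {:V}) -> R => continuous f)).
- by move=> r; exact: (@cst_continuous _ _ (0 : R)).
- by move=> f g hf hg r; exact: (cvgD (hf r) (hg r)).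
- move=> i _ r.
  exact: (@cvgMr_tmp _ _ _ _ _ _ _ (@coord_continuous R 1 _ 0 i r)).
Qed.

Lemma smooth_cst (c : R) : smooth (fun _ : V => c).
Proof.
have cont (c' : R) : continuous ((fun _ : V => c') \o @chart R V).
  exact: cst_continuous.
move=> k; elim: k c => [|k IH] c; split => // v.
split=> [z|]; first exact: derivable_cst.
have -> : (fun z => tangent z v (fun _ : V => c)) = fun=> 0.
  by apply/funext => z; apply/tangent_val/is_derive_cst.
exact: IH.
Qed.

Lemma smooth_scalar (l : {scalar V}) : smooth l.
Proof.
have cont := @continuous_scalar_chart l.
case=> [|k]; split => // v; split=> [z|].
  exact: (@ex_derive _ _ _ _ _ _ _ (scalar_is_derive _ _ _)).
have -> : (fun z => tangent z v l) = fun=> l v.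
  by apply/funext => z; apply: tangent_scalar.
exact: smooth_cst.
Qed.

(** A linear map is its own tangent map, because its coordinates are linear
forms; this turns invariance under [Sp] into an algebraic condition. *)
Lemma Tmap_lfun (g : 'End(V)) z v : Tmap g z v = g v.
Proof.
rewrite [RHS](coord_vbasis (memvf _)); apply: eq_bigr => i _; congr (_ *: _).
exact: (tangent_scalar (coord (vbasis {:V}) i \o g)).
Qed.

Lemma Tmap_cst c z v : Tmap (fun _ : V => c) z v = 0.
Proof.
rewrite /Tmap big1 // => i _.
have -> : tangent z v (vcoord i \o fun=> c) = 0.
  exact/tangent_val/is_derive_cst.
by rewrite scale0r.
Qed.

(** Constant fields commute, so that they test the exterior derivative without
any bracket term. *)
Lemma ext_deriv_cst (theta : one_form V) x y z :
  ext_deriv theta (fun=> x) (fun=> y) z =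
  tangent z x (theta^~ y) - tangent z y (theta^~ x).
Proof.
have br : Defs.contract theta (lie_bracket (fun=> x) (fun=> y)) z = 0.
  rewrite /Defs.contract (_ : lie_bracket _ _ z = 0) ?linear0 //.
  by rewrite /lie_bracket !Tmap_cst subrr.
by rewrite /ext_deriv br subr0.
Qed.
End Lines.

(** * Bilinear forms and symplectic transvections *)

Section Bilinear.
Variables (R : realType) (V : vectType R).

(** Leibniz rule for the pairing of the position with a vector field.  The field
is differentiable only through its coordinates, whence the expansion of [Y] in
the basis. *)
Lemma biscalar_is_derive (B : {biscalar V}) (Y : V -> V) z v :
  smooth_map Y ->
  is_derive (0 : R) 1 (fun t : R => B (z + t *: v) (Y (z + t *: v)))
    (B v (Y z) + B z (Tmap Y z v)).
Proof.
move=> smY.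
pose b i := (vbasis {:V})`_i.
have -> : (fun t : R => B (z + t *: v) (Y (z + t *: v))) =
    \sum_(i < \dim {:V}) ((fun t : R => vcoord i (Y (z + t *: v))) *
      (cst (B z (b i)) + (B v (b i) \*: id))).
  apply/funext => t; rewrite fct_sumE {1}(coord_vbasis (memvf (Y _))).
  rewrite linear_sumr; apply: eq_bigr => i _.
  rewrite linearZr_LR linearDl linearZl_LR /=.
  by rewrite [t * _]mulrC.
pose d i :=
  vcoord i (Y z) * B v (b i) + B z (b i) * tangent z v (vcoord i \o Y).
have -> : B v (Y z) + B z (Tmap Y z v) = \sum_(i < \dim {:V}) d i.
  rewrite {1}(coord_vbasis (memvf (Y z))) /Tmap !linear_sumr -big_split /=.
  by apply: eq_bigr => i _; rewrite !linearZr_LR /= /d [B z _ * _]mulrC.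
apply: is_derive_sum => i; apply: is_derive_eq.
  exact: (is_deriveM (smooth_is_derive z v (smY i))
    (is_deriveD (is_derive_cst _ _ _) (is_deriveZ _ (is_derive_id _ _)))).
have at0 : (cst (B z (b i)) + (B v (b i) \*: id)) (0 : R) = B z (b i).
  exact: etrans (congr1 (+%R _) (mulr0 _)) (addr0 _).
by rewrite at0 /= scale0r addr0 /GRing.scale /= add0r mulr1.
Qed.

Lemma alternating_skew (Omega : {biscalar V}) x y :
  (forall x, Omega x x = 0) -> Omega x y = - Omega y x.
Proof.
move=> alt; apply/eqP; rewrite -addr_eq0; apply/eqP.
by have := alt (x + y); rewrite linearDl !linearDr !alt add0r addr0 addrC.
Qed.

Definition transvection (Omega : {biscalar V}) (c : R) (u x : V) : V :=
  x + (c * Omega u x) *: u.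

Lemma transvection_is_linear Omega c u : linear (transvection Omega c u).
Proof.
move=> a x y; rewrite /transvection linearPr mulrDr scalerDl scalerDr scalerA.
by rewrite mulrCA -!addrA; congr (_ + _); rewrite addrCA.
Qed.

HB.instance Definition _ Omega c u := GRing.isLinear.Build R V V *:%R
  (transvection Omega c u) (transvection_is_linear Omega c u).

(** The coefficient [Omega u x] is unchanged when [x] moves along [u], since
[Omega u u = 0]; so transvections along [u] add up their parameters. *)
Lemma transvectionK (Omega : {biscalar V}) c u :
  (forall x, Omega x x = 0) ->
  cancel (transvection Omega c u) (transvection Omega (- c) u).
Proof.
move=> alt x; rewrite /transvection linearDr linearZr_LR /= alt mulr0 addr0.
by rewrite mulNr scaleNr addrK.
Qed.

Lemma transvection_Sp (Omega : {biscalar V}) c u :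
  (forall x, Omega x x = 0) -> Sp Omega (linfun (transvection Omega c u)).
Proof.
move=> alt; split.
  exists (transvection Omega (- c) u) => x; rewrite !lfunE /=.
    exact: transvectionK.
  by have := transvectionK (- c) u alt x; rewrite opprK.
move=> x y; rewrite !lfunE /= /transvection.
rewrite linearDl !linearDr !linearZl_LR !linearZr_LR /= alt.
rewrite mulr0 !scaler0 addr0 (alternating_skew x u alt) /GRing.scale /= mulrN.
by rewrite -!mulrA (mulrC (Omega u y)) addrNK.
Qed.

(** The transvection along the difference [u = w - z] moves [z] by
[(c * Omega u z) *: u], and [Omega u z = Omega w z]; hence the choice of [c]. *)
Lemma Sp_moves_nonorthogonal (Omega : {biscalar V}) z w :
  (forall x, Omega x x = 0) -> Omega w z != 0 ->
  exists2 g, Sp Omega g & g z = w.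
Proof.
move=> alt nz; exists (linfun (transvection Omega (Omega w z)^-1 (w - z))).
  exact: transvection_Sp.
rewrite lfunE /= /transvection linearBl alt subr0 mulVf // scale1r.
by rewrite addrC subrK.
Qed.

(** * Uniqueness *)

(** [z] and [s *: z] are orthogonal, hence not related by one transvection
along their difference; two transvections through some [w] relate them.  The
function [p] below is then constant off [0], and its continuity at [0] makes
that constant equal to [p 0 = 0]. *)
Lemma Sp_invariant_null_on_rays (Omega : {biscalar V}) theta z :
  symplectic Omega -> smooth_form theta -> Sp_invariant Omega theta ->
  theta z z = 0.
Proof.
move=> [alt nd] sm inv.
have [->|/eqP z0] := eqVneq z 0; first by rewrite linear0.
have [w wz] : exists w, Omega w z != 0.
  apply: contra_notP z0 => no_w; apply: nd => y; rewrite alternating_skew //.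
  have [->|yz] := eqVneq (Omega y z) 0; first by rewrite oppr0.
  by case: no_w; exists y.
have orbit (g : 'End(V)) y : Sp Omega g -> theta (g y) (g y) = theta y y.
  by move=> Sg; rewrite -(inv g Sg y y) /pullback Tmap_lfun.
pose p := fun s : R => s * (theta (s *: z) z : R).
have p_off0 s : s != 0 -> p s = theta z z.
  move=> s0; have -> : p s = theta (s *: z) (s *: z) by rewrite linearZ.
  have [g Sg gz] := Sp_moves_nonorthogonal alt wz.
  have szw : Omega (s *: z) w != 0.
    by rewrite linearZl_LR /= alternating_skew // mulf_neq0 ?oppr_eq0.
  have [g' Sg' gw] := Sp_moves_nonorthogonal alt szw.
  by rewrite -gw orbit // -gz orbit.
have p_cont : {for 0, continuous p}.
  apply/differentiable_continuous/derivable1_diffP/derivableM.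
    exact: derivable_id.
  exact: (@ex_derive _ _ _ _ _ _ _ (smooth_is_derive_ray z 0 (sm z))).
have p0 : p s @[s --> 0^'] --> p 0 by exact/continuous_withinNx.
have pc : p s @[s --> 0^'] --> (theta z z : R).
  apply: cvg_near_cst; near=> s; apply: p_off0.
  by near: s; exact: nbhs_dnbhs_neq.
by rewrite (cvg_unique _ pc p0) // /p mul0r.
Unshelve. all: by end_near. Qed.

(** Cartan's formula for the Euler field [E], in elementary terms: as
[theta E = 0], the Lie derivative of [theta] along [E] is the contraction of
[Omega] with [E], and integrating it along the ray through [z] recovers
[theta]. *)
Lemma potential_null_on_rays (Omega : {biscalar V}) theta z v :
  symplectic_potential (induced_form Omega) theta ->
  (forall w, theta w w = 0) ->
  theta z v = 2^-1 * Omega z v.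
Proof.
move=> [sm pot] eul.
have closed w x y :
    tangent w x (theta^~ y) - tangent w y (theta^~ x) = Omega x y.
  by rewrite -ext_deriv_cst pot // => i; apply: smooth_cst.
(* The derivative of [theta w w = 0] in the direction [v], at [w = t *: z]. *)
have eul' (t : R) : theta (t *: z) v + t * tangent (t *: z) v (theta^~ z) = 0.
  set w := t *: z.
  have : is_derive (0 : R) 1
    ((t \*: (fun s : R => (theta (w + s *: v) z : R))) +
     id * (fun s : R => (theta (w + s *: v) v : R)))
     (t *: tangent w v (theta^~ z) +
      ((0 : R) *: tangent w v (theta^~ v) + (theta (w + 0 *: v) v : R) *: 1)).
    by apply: is_deriveD; [apply: is_deriveZ|apply: is_deriveM];
      apply: smooth_is_derive.
  rewrite !scale0r add0r addr0 [_ *: 1]mulr1.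
  have -> : (t \*: (fun s : R => (theta (w + s *: v) z : R))) +
     id * (fun s : R => (theta (w + s *: v) v : R)) = cst 0.
    apply/funext => s /=; rewrite -[RHS](eul (w + s *: v)).
    by rewrite [in RHS]linearD !linearZ.
  move=> d; rewrite addrC -(@derive_val _ _ _ _ _ _ _ d).
  by rewrite (@derive_val _ _ _ _ _ _ _ (is_derive_cst _ _ _)).
(* [c * t ^+ 2] is the primitive of [t * Omega z v] vanishing at [0]. *)
pose c := 2^-1 * Omega z v.
pose q := id * (fun t : R => (theta (t *: z) v : R)) - (c \*: (@id R ^+ 2)).
have dq (t : R) : is_derive t 1 q 0.
  apply: is_derive_eq.
    exact: (is_deriveB
      (is_deriveM (is_derive_id _ _) (smooth_is_derive_ray z t (sm v)))
      (is_deriveZ c (is_deriveX 2 (is_derive_id _ _)))).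
  have /eqP := closed (t *: z) z v; rewrite subr_eq => /eqP ->.
  have c2 : c * (2 * t) = t * Omega z v.
    by rewrite /c mulrA [_ * 2]mulrAC mulVf ?mul1r ?pnatr_eq0 // mulrC.
  rewrite /GRing.scale /= !mulr1 expr1 c2 mulrDr addrC.
  by rewrite -addrA addKr addrC eul'.
have q01 : 0 * (theta (0 *: z) v : R) - c * 0 ^+ 2 =
           1 * (theta (1 *: z) v : R) - c * 1 ^+ 2.
  exact: is_derive_0_is_cst dq.
move: q01; rewrite mul0r expr0n /= mulr0 subrr expr1n mul1r mulr1 scale1r.
by move/esym/eqP; rewrite subr_eq0 => /eqP.
Qed.

(** * The invariant potential *)

(** Half the contraction of [Omega] with the Euler field [z |-> z]. *)
Definition Euler_form (Omega : {biscalar V}) : one_form V :=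
  fun z => linfun (Omega (2^-1 *: z) : V -> R^o).

Lemma Euler_formE (Omega : {biscalar V}) z v :
  Euler_form Omega z v = 2^-1 * Omega z v.
Proof. by rewrite lfunE /= linearZl_LR. Qed.

Lemma Euler_form_potential (Omega : {biscalar V}) :
  (forall x, Omega x x = 0) ->
  symplectic_potential (induced_form Omega) (Euler_form Omega).
Proof.
move=> alt; split=> [v|X Y smX smY z].
  have -> : (fun z => Euler_form Omega z v : R) = (- 2^-1) \*: Omega v.
    apply/funext => z.
    by rewrite Euler_formE (alternating_skew _ _ alt) mulrN -mulNr.
  exact: smooth_scalar.
have actE v (Z : V -> V) : smooth_map Z ->
    tangent z v (Defs.contract (Euler_form Omega) Z) =
    2^-1 * (Omega v (Z z) + Omega z (Tmap Z z v)).
  move=> smZ; apply: tangent_val.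
  have -> : (fun t : R => Defs.contract (Euler_form Omega) Z (z + t *: v)) =
      2^-1 \*: (fun t : R => Omega (z + t *: v) (Z (z + t *: v))).
    by apply/funext => t; rewrite [LHS]Euler_formE.
  by apply: is_deriveZ; apply: biscalar_is_derive.
rewrite /ext_deriv /act !actE // [Defs.contract _ _ _]Euler_formE linearBr.
rewrite -!mulrBr (alternating_skew (Y z) (X z) alt) /induced_form.
rewrite [- (- _ + _)]opprD opprK addrACA addrK mulrDr.
by rewrite ![2^-1 * _]mulrC -splitr.
Qed.

Lemma Euler_form_invariant (Omega : {biscalar V}) :
  Sp_invariant Omega (Euler_form Omega).
Proof.
by move=> g [_ gO] z v; rewrite /pullback Tmap_lfun !Euler_formE gO.
Qed.
End Bilinear.

Theorem theorem0p1 (R : realType) (V : vectType R) (Omega : {biscalar V})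
    (Omega_symplectic : symplectic Omega) :
  exists theta0 : one_form V,
    unique (fun theta : one_form V =>
        symplectic_potential (induced_form Omega) theta /\
        Sp_invariant Omega theta) theta0 /\
    forall z v : V, theta0 z v = 2^-1 * Omega z v.
Proof.
have alt := proj1 Omega_symplectic.
exists (Euler_form Omega); split; last exact: Euler_formE.
split.
  by split; [exact: Euler_form_potential|exact: Euler_form_invariant].
move=> theta [pot inv]; apply/funext => z; apply/lfunP => v.
rewrite Euler_formE (potential_null_on_rays z v pot) // => w.
exact: Sp_invariant_null_on_rays (proj1 pot) inv.
Qed.
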